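(* Let $p>1$. Then for all $r\in(0,\infty)$ the following hold. (i) If $\mu\ge 1$, then $$S_\mu(r)^p\le C_\mu(r)^p\,\Gamma(\mu+1/2)^{p-1}\,\zeta(\mu+1/2)^{p-1}\,\Gamma(p+\mu+1/2)\,\zeta(p+\mu+1/2).$$ (ii) If $\mu\ge \frac32$, then $$S_\mu(r)^p\le \frac{C_\mu(r)^p}{2^{p/2}}\,\Gamma(\mu+1/2)^{p-1}\,\zeta(\mu+1/2)^{p-1}\,\Gamma(p+\mu+1/2)\,\zeta(p+\mu+1/2).$$ Moreover, for all $r\in(0,\infty)$, $$S(r)\le \frac{\sqrt{15\pi\,\zeta(3/2)\,\zeta(7/2)}}{4\sqrt{2r}}\,\pi\qquad\text{and}\qquad S_{3/2}(r)\le\frac{\pi^3}{9\sqrt{10}\,r^2}.$$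
   Context: For $\mu>0$ and $r>0$, the generalized Mathieu series is $S_\mu(r)=\sum_{n=1}^\infty \frac{2n}{(n^2+r^2)^{\mu+1}}$, and the Mathieu series is $S(r)=S_1(r)=\sum_{n=1}^\infty\frac{2n}{(n^2+r^2)^2}$. Further, $C_\mu(r)=\frac{\sqrt{\pi}}{(2r)^{\mu-1/2}\,\Gamma(\mu+1)}$. $\Gamma$ is the Gamma function and $\zeta(p)=\sum_{n=1}^\infty n^{-p}$ ($p>1$) is the Riemann zeta function. *)

(* Defs.v *)
From HB Require Import structures.
From mathcomp Require Import all_boot all_order all_algebra.
From mathcomp Require Import all_classical all_reals all_analysis.
Set Implicit Arguments.
Unset Strict Implicit.
Unset Printing Implicit Defensive.
Import Order.TTheory GRing.Theory Num.Theory.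
Import numFieldNormedType.Exports.
Local Open Scope classical_set_scope.
Local Open Scope ring_scope.

(** Intended for [0 < s], where the integral is finite. *)
Definition Gamma (R : realType) (s : R) : R :=
  \int[lebesgue_measure]_(t in `]0, +oo[) (t `^ (s - 1) * expR (- t)).

(** Intended for [1 < p]; [riemannR p k] is [(k + 1)^(-p)], so the series starts
    at [n = 1]. *)
Definition zeta (R : realType) (p : R) : R := limn (series (riemannR p)).

(** The term of index [k] is the one for [n = k + 1]; the series converges for
    [0 < mu]. *)
Definition mathieu_gen (R : realType) (mu r : R) : R :=
  limn (series (fun k : nat =>
    2 * k.+1%:R / (k.+1%:R ^+ 2 + r ^+ 2) `^ (mu + 1))).

Definition mathieu (R : realType) (r : R) : R := mathieu_gen 1 r.

Definition mathieu_const (R : realType) (mu r : R) : R :=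
  Num.sqrt pi / ((2 * r) `^ (mu - 1 / 2) * Gamma (mu + 1)).

(* Main.v *)
(** No integral representation by Bessel functions is needed. From
    [n^2 + r^2 >= 2 r n] and [(n^2 + r^2)^4 >= 4 r n^7] each term of the series
    is at most [sqrt 2 / (2 r) `^ (mu - 1/2) / n `^ (mu + 3/2)], so that
    [S_mu(r) <= sqrt 2 zeta(mu + 3/2) / (2 r) `^ (mu - 1/2)].
    Since [Gamma(mu + 1) / Gamma(mu + 3/2)] is at most
    [(1 + 1 / (mu + 1/2)) / 2], the factor [sqrt 2] is at most
    [sqrt pi Gamma(mu + 3/2) / Gamma(mu + 1)] when [mu >= 1], with a further
    factor [sqrt 2] to spare when [mu >= 3/2]. Finally Hoelder's inequality
    bounds the [p]-th powers of [zeta] and [Gamma] at [a + 1] by their values at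
    [a] and [a + p], where [a = mu + 1/2]. The two closing bounds follow from
    termwise estimates of the same kind and [pi >= 3]. *)
Require Import Defs.
From mathcomp Require Import all_boot all_order all_algebra.
From mathcomp Require Import all_classical all_reals all_analysis.
From mathcomp Require Import measurable_realfun ring lra.
Import Order.TTheory GRing.Theory Num.Theory.
Import numFieldNormedType.Exports.
Local Open Scope ring_scope.

(** * The lower bound 3 for [pi] *)

Lemma sin_le_id (R : realType) (x : R) : 0 <= x -> sin x <= x.
Proof.
move=> x0; rewrite -subr_ge0.
have -> : 0 = 0 - sin 0 :> R by rewrite sin0 subr0.
have df y : is_derive (y : R) 1 (fun y => y - sin y) (1 - cos y).
  exact: is_deriveB.
apply: (@ger0_derive1_le_cc _ (fun y => y - sin y) 0 x) => //.
- by move=> y _; rewrite derive1E derive_val subr_ge0 cos_le1.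
- apply: continuous_subspaceT => y.
  by apply/differentiable_continuous/derivable1_diffP; exact: ex_derive.
- by rewrite in_itv/= lexx.
- by rewrite in_itv/= x0 lexx.
Qed.

(** The triple-angle formula at [pi / 6] makes [s] a root of
    [4 s^3 - 3 s + 1 = (s + 1) (2 s - 1)^2], and [s] is positive. *)
Lemma sin_pi6 (R : realType) : sin (pi / 6) = 1 / 2 :> R.
Proof.
have pi0 := pi_gt0 R; pose s : R := sin (pi / 6).
pose c : R := cos (pi / 6); rewrite -/s.
have cs : c ^+ 2 + s ^+ 2 = 1 by exact: cos2Dsin2.
have : sin (pi / 6 + (pi / 6 + pi / 6)) = 1 :> R.
  by rewrite (_ : _ + _ = pi / 2) ?sin_pihalf//; lra.
rewrite sinD cosD sinD -/s -/c => e.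
have s0 : 0 < s by apply: sin_gt0_pi; lra.
have /eqP : (s + 1) * (2 * s - 1) ^+ 2 = 0.
  have c2 : c ^+ 2 = 1 - s ^+ 2 by lra.
  have : s * (c ^+ 2 - s ^+ 2) + 2 * s * c ^+ 2 = 1 by rewrite -[RHS]e; ring.
  by rewrite c2; lra.
rewrite mulf_eq0 expf_eq0/= => /orP[/eqP|/eqP]; lra.
Qed.

Lemma pi_ge3 (R : realType) : 3 <= pi :> R.
Proof.
have := @sin_le_id R (pi / 6); rewrite sin_pi6; have := pi_gt0 R; move=> h.
by move=> /(_ ltac:(lra)); lra.
Qed.

(** * Hoelder's inequality in linearized form *)

(** Young's inequality for [t / l] and 1, multiplied by [l]. The bound is linear in 1 and [t ^ p],
    so it can be summed or integrated against any weight before [l] is chosen. *)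
Lemma young_scaled {R : realType} (p l t : R) : 1 < p -> 0 < l -> 0 <= t ->
  t <= (1 - p^-1) * l + l `^ (1 - p) / p * t `^ p.
Proof.
move=> p1 l0 t0; have p0 : 0 < p by lra.
have q0 : 0 < 1 - p^-1 by rewrite subr_gt0 invf_lt1.
have := @conjugate_powR R (t / l) 1 p (1 - p^-1)^-1 (divr_ge0 t0 (ltW l0)) ler01 p0.
rewrite invr_gt0 invrK powR1 mulr1 mul1r => /(_ q0) /(_ ltac:(ring)).
rewrite -(ler_pM2l l0) mulrCA divff ?gt_eqF// mulr1 => /le_trans; apply.
have l0' := ltW l0; rewrite powRM ?invr_ge0// -powR_inv1// -powRrM mulN1r.
rewrite powRB ?(gt_eqF l0) ?implybT// powRr1// powRN le_eqVlt; apply/orP; left.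
by apply/eqP; ring.
Qed.

(* The bound is optimal at [l = (Mp / M0) `^ p^-1]. *)
Lemma interpolation {R : realType} (p M0 M1 Mp : R) : 1 < p ->
  0 < M0 -> 0 <= M1 -> 0 < Mp ->
  (forall l, 0 < l -> M1 <= (1 - p^-1) * l * M0 + l `^ (1 - p) / p * Mp) ->
  M1 `^ p <= M0 `^ (p - 1) * Mp.
Proof.
move=> p1 M00 M10 Mp0 H; have p0 : 0 < p by lra.
pose l := (Mp / M0) `^ p^-1.
have l0 : 0 < l by rewrite powR_gt0 ?divr_gt0.
have lp : l `^ p = Mp / M0.
  by rewrite -powRrM mulVf ?gt_eqF// powRr1// divr_ge0 ?ltW.
(* As [l ^ p = Mp / M0], the second term equals [l * M0 / p], and the weights [1 - 1 / p] and
   [1 / p] add up to 1. *)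
have {}H : M1 <= l * M0.
  apply: (le_trans (H l l0)).
  rewrite powRB ?(gt_eqF l0) ?implybT// powRr1 ?(ltW l0)// lp.
  rewrite le_eqVlt; apply/orP; left.
  by apply/eqP; field; rewrite !gt_eqF.
have := @ge0_ler_powR R p (ltW p0) M1 (l * M0).
rewrite !nnegrE M10 mulr_ge0 ?(ltW l0) ?(ltW M00)//.
move=> /(_ isT isT H)/le_trans; apply.
rewrite powRM ?(ltW l0) ?(ltW M00)// lp -mulrA -(mulr_powRB1 (ltW M00) p0).
by rewrite mulKf ?(gt_eqF M00)// mulrC.
Qed.

(** * The zeta function: convergence, positivity, interpolation *)

Section zeta.
Context {R : realType}.

(* Telescoping: [1 + d / n <= (n / (n - 1)) `^ d] follows from [1 + x <= expR x]. *)
Lemma riemannR_telescope (d : R) (n : nat) : 0 < d ->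
  riemannR (1 + d) n.+1 <= d^-1 * (riemannR d n - riemannR d n.+1).
Proof.
move=> d0; rewrite /riemannR/=; set x : R := n.+1%:R; set y : R := n.+2%:R.
have x0 : 0 < x by rewrite ltr0n.
have y0 : 0 < y by rewrite ltr0n.
have yx : y = x + 1 by rewrite /x /y natr1.
have xy : 1 + d / y <= (y / x) `^ d.
  rewrite /powR gt_eqF ?divr_gt0//; apply: le_trans (expR_ge1Dx _).
  rewrite lerD2l ler_pM2l//.
  (* [ln (y / x) = - ln (1 - 1 / y) >= 1 / y]. *)
  have := @le_ln1Dx R (- y^-1); rewrite ltrN2 invf_lt1// => /(_ ltac:(lra)).
  have -> : 1 - y^-1 = (y / x)^-1.
    by rewrite invf_div -[x](addrK 1) -yx; field; rewrite gt_eqF.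
  by rewrite lnV ?posrE ?divr_gt0// lerN2.
move: xy; rewrite powRM ?invr_ge0 ?(ltW x0) ?(ltW y0)//.
rewrite -(powR_inv1 (ltW x0)) -powRrM mulN1r powRN.
rewrite -(ler_pdivrMl _ _ (powR_gt0 d y0)) ler_pdivlMl//.
rewrite powRD ?(gt_eqF y0) ?implybT// powRr1 ?(ltW y0)// invfM => xy.
rewrite lerBrDr; apply: le_trans xy; rewrite le_eqVlt; apply/orP; left.
by apply/eqP; ring.
Qed.

Lemma series_riemannR_le (d : R) (n : nat) : 0 < d ->
  series (riemannR (1 + d)) n <= 1 + d^-1.
Proof.
(* The induction keeps the telescoped remainder; the term of index 0 is 1. *)
move=> d0; suff : series (riemannR (1 + d)) n.+1 <= 1 + d^-1 * (1 - riemannR d n).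
  rewrite seriesSr => H; apply: le_trans (_ : _ <= 1 + d^-1 * (1 - riemannR d n)) _.
    by apply: le_trans H; rewrite lerDl ltW// riemannR_gt0//; lra.
  rewrite lerD2l ger_pMr ?invr_gt0// gerBl ltW// riemannR_gt0// ltW//.
elim: n => [|n ih].
  by rewrite seriesSr {1}/series/= big_geq// /riemannR/= !powR1 invr1; lra.
rewrite seriesSr; have := riemannR_telescope d n d0; nra.
Qed.

Lemma is_cvg_series_riemannR (s : R) : 1 < s -> cvgn (series (riemannR s)).
Proof.
move=> s1; have -> : s = 1 + (s - 1) by ring.
apply: nondecreasing_is_cvgn; last first.
  exists (1 + (s - 1)^-1) => _ [n _ <-]; apply: series_riemannR_le; lra.
by apply: nondecreasing_series => k _ _; rewrite ltW// riemannR_gt0//; lra.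
Qed.

Lemma zeta_gt0 (s : R) : 1 < s -> 0 < zeta s.
Proof.
move=> s1; apply: (@lt_le_trans _ _ (series (riemannR s) 1)).
  by rewrite /series/= big_nat1 riemannR_gt0//; lra.
apply: nondecreasing_cvgn_le; last exact: is_cvg_series_riemannR.
by apply: nondecreasing_series => k _ _; rewrite ltW// riemannR_gt0//; lra.
Qed.

Lemma zeta2_le2 : zeta 2 <= 2 :> R.
Proof.
apply: limr_le; first by apply: is_cvg_series_riemannR; lra.
apply: nearW => n; have := @series_riemannR_le 1 n ltr01.
by rewrite invr1 (_ : 1 + 1 = 2)//; ring.
Qed.

(** [young_scaled] at [t = 1 / n] is summed with the weights [n ^ (- a)], on partial sums first and
    then in the limit. *)
Lemma zeta_interpolation (p a : R) : 1 < p -> 1 < a ->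
  zeta (a + 1) `^ p <= zeta a `^ (p - 1) * zeta (a + p).
Proof.
move=> p1 a1; apply: interpolation => //; try by (apply: zeta_gt0; lra).
  by apply/ltW/zeta_gt0; lra.
move=> l l0.
have cvgz (s : R) : 1 < s -> (series (riemannR s) @ \oo --> zeta s)%classic.
  by move=> s1; exact: is_cvg_series_riemannR.
apply: (ler_cvg_to (cvgz (a + 1) _) (cvgD (cvgMl_tmp (cvgz a _))
  (cvgMl_tmp (cvgz (a + p) _)))); try lra.
apply: nearW => n; rewrite fctE /series/= !mulr_sumr -big_split/=.
apply: ler_sum => k _; rewrite /riemannR; set x : R := k.+1%:R.
have x0 : 0 < x by rewrite ltr0n.
rewrite !(@powRD _ x) ?(gt_eqF x0) ?implybT// powRr1 ?(ltW x0)// !invfM.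
have := @young_scaled R p l x^-1 p1 l0; rewrite invr_ge0 (ltW x0) => /(_ isT).
rewrite -{2}(powR_inv1 (ltW x0)) -powRrM mulN1r powRN.
rewrite -(ler_pM2l (_ : 0 < (x `^ a)^-1)) ?invr_gt0 ?powR_gt0//.
by move=> /le_trans; apply; rewrite le_eqVlt; apply/orP; left; apply/eqP; ring.
Qed.
End zeta.

(** * The Gamma function: integrability, functional equation, convexity estimates *)

Section gamma.
Context {R : realType}.
Local Open Scope classical_set_scope.
Implicit Types c k t s p a x : R.
Notation mu := (@lebesgue_measure R).

(** An integrable majorant with an elementary antiderivative. *)
Let decay (t : R) := expR (- (t / 2)).
(** The integrand of [Gamma (k + 1)]. *)
Let gamd (k t : R) := t `^ k * expR (- t).

(** Raise [t / (2 k) <= exp (t / (2 k))] to the power [k]. *)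
Let gamd_le k t : 0 < k -> 0 <= t -> gamd k t <= (2 * k) `^ k * decay t.
Proof.
move=> k0 t0; rewrite /gamd /decay.
have -> : - (t / 2) = t / 2 - t by lra.
rewrite expRD mulrA ler_pM2r ?expR_gt0//.
have k20 : 0 < 2 * k by lra.
have -> : t / 2 = t / (2 * k) * k by field; rewrite gt_eqF.
rewrite expRM -powRM ?(ltW k20) ?expR_ge0//.
apply: ge0_ler_powR; rewrite ?nnegrE ?(ltW k0)//.
  by rewrite mulr_ge0 ?expR_ge0 ?(ltW k20).
rewrite -ler_pdivrMl// mulrC; apply: le_trans (expR_ge1Dx _); lra.
Qed.

Let decay_cvg : decay t @[t --> +oo%R] --> 0%R.
Proof.
apply: (@cvg_comp _ _ _ (fun t : R => t / 2) (fun t => expR (- t))).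
  by apply: gt0_cvgMly.
exact: cvgr_expR.
Qed.

Let decay_derive (c t : R) :
  is_derive t 1 (fun t => c * decay t) (- (c / 2) * decay t).
Proof. by rewrite /decay; apply: is_derive_eq; rewrite /GRing.scale/=; ring. Qed.

Let decay_cont (c : R) : continuous (fun t => c * decay t).
Proof.
by move=> t; apply/differentiable_continuous/derivable1_diffP; exact: ex_derive.
Qed.

Let gamd_derive k t : 0 < t ->
  is_derive t 1 (gamd k) (k * gamd (k - 1) t - gamd k t).
Proof.
move=> t0; have dk := is_derive1_powR k t0.
by rewrite /gamd; apply: is_derive_eq; rewrite /GRing.scale/=; ring.
Qed.

Let gamd_cvg0 k : 0 < k -> gamd k t @[t --> 0^'+] --> gamd k 0.
Proof.
move=> k0; rewrite /gamd powR0 ?gt_eqF// mul0r -[X in _ --> X](mul0r (expR (- 0))).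
apply: cvgM; first exact: powR_cvg0.
apply: cvg_at_right_filter; apply: continuous_comp; last exact: continuous_expR.
exact: opp_continuous.
Qed.

Let gamd_cvgy k : 0 < k -> gamd k t @[t --> +oo%R] --> 0%R.
Proof.
move=> k0; apply: (@squeeze_cvgr _ _ _ _ (cst 0) (fun t => (2 * k) `^ k * decay t)).
- near=> t; rewrite mulr_ge0 ?powR_ge0 ?expR_ge0//= gamd_le//.
- exact: cvg_cst.
- by rewrite -[X in _ --> X](mulr0 ((2 * k) `^ k)); apply: cvgMl_tmp.
Unshelve. all: by end_near. Qed.

Let gamd_cont k : 0 < k -> {within `[0%R, +oo[, continuous (gamd k)}.
Proof.
move=> k0; apply/continuous_within_itvcyP; split; last exact: gamd_cvg0.
move=> t; rewrite in_itv/= andbT => t0.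
apply/differentiable_continuous/derivable1_diffP.
by case: (gamd_derive k _ t0).
Qed.

Let gamd_meas k (D : set R) : measurable D -> measurable_fun D (EFin \o gamd k).
Proof.
move=> mD; apply/measurable_EFinP/measurable_funTS; apply: measurable_funM => //.
by apply: measurableT_comp => //; exact: measurable_oppr.
Qed.

(** The exact value matters: in [GammaS] it cancels the boundary term of the added [decay]. *)
Let integral_decay (c : R) : 0 <= c ->
  (\int[mu]_(t in `[0%R, +oo[) (c * decay t)%:E = (2 * c)%:E)%E.
Proof.
move=> c0; rewrite (@ge0_continuous_FTC2y _ _ (fun t => - (2 * c) * decay t) _ 0).
- by rewrite /decay mul0r oppr0 expR0 mulr1 EFinN oppeK add0e.
- by move=> x _; rewrite mulr_ge0// expR_ge0.
- exact: continuous_subspaceT (decay_cont c).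
- by rewrite -[X in _ --> X](mulr0 (- (2 * c))); apply: cvgMl_tmp.
- by move=> x _; exact: ex_derive.
- by apply: cvg_at_right_filter; exact: decay_cont.
- move=> x _; rewrite derive1E (@derive_val _ _ _ _ _ _ _ (decay_derive _ _)).
  by field.
Qed.

Let integrable_decay (c : R) : 0 <= c ->
  mu.-integrable `[0%R, +oo[ (EFin \o (fun t => c * decay t)).
Proof.
move=> c0; apply/integrableP; split.
  apply/measurable_EFinP/measurable_funTS.
  exact: continuous_measurable_fun (decay_cont c).
under eq_integral do rewrite /= ger0_norm ?mulr_ge0 ?expR_ge0//.
by rewrite integral_decay// ltry.
Qed.

Let integrable_gamd k : 0 < k -> mu.-integrable `[0%R, +oo[ (EFin \o gamd k).
Proof.
move=> k0; apply: le_integrable (integrable_decay _ (powR_ge0 (2 * k) k)) => //.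
- exact: gamd_meas.
- move=> t /=; rewrite in_itv/= andbT => t0.
  by rewrite lee_fin !ger0_norm ?mulr_ge0 ?powR_ge0 ?expR_ge0// gamd_le.
Qed.

Lemma GammaE s : 1 < s ->
  Gamma s = \int[mu]_(t in `[0%R, +oo[) (t `^ (s - 1) * expR (- t)).
Proof.
move=> s1; rewrite /Gamma Rintegral_itv_obnd_cbnd//.
apply: integrableS (@integrable_gamd (s - 1) _) => //; last by rewrite subr_gt0.
by move=> t /=; rewrite !in_itv/= !andbT => /ltW.
Qed.

Lemma Gamma_gt0 s : 1 < s -> 0 < Gamma s.
Proof.
move=> s1; rewrite GammaE// /Rintegral fine_gt0//.
have s10 : 0 < s - 1 by rewrite subr_gt0.
(* [fine] sends infinity to 0, so finiteness is proved along with positivity. The latter holds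
   because the integrand is at least [exp (- 2)] on [[1, 2]]. *)
apply/andP; split; last first.
  have /integrableP[_] := integrable_gamd _ s10; apply: le_lt_trans.
  under [leRHS]eq_integral do
    rewrite /= ger0_norm ?mulr_ge0 ?powR_ge0 ?expR_ge0//.
  by [].
apply: (@lt_le_trans _ _ (\int[mu]_(t in `[1%R, 2%R]) (expR (- 2))%:E)%E).
  rewrite integral_cst//= lebesgue_measure_itv/= lte_fin ltr1n.
  by rewrite -EFinB -EFinM lte_fin mulr_gt0 ?expR_gt0//; lra.
apply: (@le_trans _ _ (\int[mu]_(t in `[1%R, 2%R]) (gamd (s - 1) t)%:E)%E).
  apply: ge0_le_integral => //.
  - exact: gamd_meas.
  - move=> t /=; rewrite in_itv/= => /andP[t1 t2]; rewrite lee_fin.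
    rewrite -[leLHS]mul1r ler_pM ?expR_ge0//; last by rewrite ler_expR lerN2.
    by rewrite -[leLHS](powRr0 t) ler_powR// ltW.
apply: ge0_subset_integral => //.
- exact: gamd_meas.
- by move=> t _; rewrite lee_fin mulr_ge0 ?powR_ge0 ?expR_ge0.
- by move=> t /=; rewrite !in_itv/= andbT => /andP[t1 _]; lra.
Qed.

(* [gamd s - s * gamd (s - 1)] changes sign, whereas the fundamental theorem of
   calculus on a half-line needs a nonnegative integrand: a multiple of [decay]
   is added to it. *)
Lemma GammaS s : 1 < s -> Gamma (s + 1) = s * Gamma s.
Proof.
(* [c] is [s] times the constant of [gamd_le] for [k = s - 1], which makes [f] nonnegative below. *)
move=> s1; have s0 : 0 < s by lra.
have s10 : 0 < s - 1 by lra.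
pose c := s * (2 * (s - 1)) `^ (s - 1).
have c0 : 0 <= c by rewrite mulr_ge0 ?powR_ge0 ?ltW.
pose f t := c * decay t + (gamd s t - s * gamd (s - 1) t).
have ig : mu.-integrable `[0%R, +oo[ (EFin \o gamd s) by exact: integrable_gamd.
have ig1 : mu.-integrable `[0%R, +oo[ (EFin \o gamd (s - 1)).
  exact: integrable_gamd.
have ig2 : mu.-integrable `[0%R, +oo[ (EFin \o (fun t => s * gamd (s - 1) t)).
  exact: (integrableZl _ s ig1).
have ig3 : mu.-integrable `[0%R, +oo[
    (EFin \o (fun t => gamd s t - s * gamd (s - 1) t)).
  exact: (integrableB _ ig ig2).
(* The antiderivative [- (2 * c) * decay t - gamd s t] is [- 2 c] at 0 and tends to 0 at
   infinity. *)
have : \int[mu]_(t in `[0%R, +oo[) f t = 2 * c.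
  rewrite (@Rintegral_ge0_continuous_FTC2y _ _
    (fun t => - (2 * c) * decay t - gamd s t) _ 0).
  - by rewrite /gamd /decay mul0r oppr0 expR0 powR0 ?gt_eqF//; lra.
  - move=> t t0; rewrite /f.
    have : s * gamd (s - 1) t <= c * decay t by rewrite -mulrA ler_pM2l// gamd_le.
    have : 0 <= gamd s t by rewrite mulr_ge0 ?powR_ge0 ?expR_ge0.
    lra.
  - have cg1 := gamd_cont _ s10; have cg := gamd_cont _ s0.
    have cd := continuous_subspaceT (decay_cont c).
    move=> t; apply: cvgD; first exact: cd.
    apply: cvgB; first exact: cg.
    by apply: cvgMl_tmp; exact: cg1.
  - rewrite -(subr0 0); apply: cvgB; last exact: gamd_cvgy.
    by rewrite -[X in _ --> X](mulr0 (- (2 * c))); apply: cvgMl_tmp.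
  - by move=> t t0; have := gamd_derive s _ t0 => ?; exact: ex_derive.
  - apply: cvgB; last exact: gamd_cvg0.
    by apply: cvg_at_right_filter; exact: decay_cont.
  - move=> t; rewrite in_itv/= andbT => t0; have := gamd_derive s _ t0 => ?.
    by rewrite derive1E derive_val /f /decay /GRing.scale/=; field.
rewrite RintegralD//; last exact: integrable_decay.
rewrite {1}/Rintegral integral_decay//= RintegralB// RintegralZl//.
rewrite !GammaE ?addrK; lra.
Qed.

(** [young_scaled] is integrated against the weight [t ^ (a - 1) * exp (- t)]. *)
Lemma Gamma_interpolation p a : 1 < p -> 1 < a ->
  Gamma (a + 1) `^ p <= Gamma a `^ (p - 1) * Gamma (a + p).
Proof.
move=> p1 a1; apply: interpolation => //; try by (apply: Gamma_gt0; lra).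
  by apply/ltW/Gamma_gt0; lra.
move=> l l0; rewrite !GammaE ?ltr_wpDr//; last by lra.
have ig k : 0 < k -> mu.-integrable `[0%R, +oo[ (EFin \o gamd k).
  exact: integrable_gamd.
rewrite -!RintegralZl//; try (apply: ig; lra).
rewrite -RintegralD//; try (apply: (integrableZl _ _ (ig _ _)) => //; lra).
apply: le_Rintegral => //.
- by apply: ig; lra.
- apply: (integrableD _ (integrableZl _ _ (ig _ _))
    (integrableZl _ _ (ig _ _))) => //; lra.
move=> t /=; rewrite in_itv/= andbT => t0.
have -> : a + 1 - 1 = a - 1 + 1 by ring.
have -> : a + p - 1 = a - 1 + p by ring.
(* At [t = 0] the exponent law requires a nonzero sum of exponents; here the sums are positive. *)
rewrite !(@powRD _ t (a - 1)); try (apply/implyP => /eqP; lra).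
rewrite powRr1//; have := @young_scaled R p l t p1 l0 t0.
move=> /(ler_wpM2l (mulr_ge0 (powR_ge0 t (a - 1)) (expR_ge0 (- t)))).
move=> H; apply: le_trans (le_trans H _).
  by rewrite le_eqVlt; apply/orP; left; apply/eqP; ring.
by rewrite le_eqVlt; apply/orP; left; apply/eqP; ring.
Qed.

(* AM-GM under the integral: [t `^ (1 / 2) <= (1 + t) / 2]. *)
Lemma Gamma_midpoint x : 3 / 2 < x ->
  Gamma x <= (Gamma (x - 1 / 2) + Gamma (x + 1 / 2)) / 2.
Proof.
move=> x32; rewrite !GammaE; [|lra..].
have ig k : 0 < k -> mu.-integrable `[0%R, +oo[ (EFin \o gamd k).
  exact: integrable_gamd.
rewrite -RintegralD//; try (apply: ig; lra).
rewrite -RintegralZr//; last first.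
  apply: (integrableD _ (ig (x - 1 / 2 - 1) _) (ig (x + 1 / 2 - 1) _)) => //.
    lra.
  lra.
apply: le_Rintegral => //.
- by apply: ig; lra.
- apply: (integrableZr _ (2^-1) (integrableD _ (ig (x - 1 / 2 - 1) _)
    (ig (x + 1 / 2 - 1) _))) => //; lra.
move=> t /=; rewrite in_itv/= andbT => t0.
have -> : x + 1 / 2 - 1 = (x - 1 / 2 - 1) + 1 by field.
have -> : x - 1 = (x - 1 / 2 - 1) + 2^-1 by field.
set y := x - 1 / 2 - 1; have y0 : 0 < y by rewrite /y; lra.
rewrite !(@powRD _ t y); try (apply/implyP => /eqP; lra).
rewrite powRr1// powR12_sqrt//; set E := expR _; set u := t `^ y.
have -> : (u * E + u * t * E) / 2 = u * ((1 + t) / 2) * E by field.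
rewrite ler_pM2r ?expR_gt0// ler_wpM2l ?powR_ge0//.
rewrite -{2}(sqr_sqrtr t0); have := sqr_ge0 (Num.sqrt t - 1); lra.
Qed.

(** In [Gamma_midpoint], the functional equation turns [Gamma (x - 1 / 2)] into
    [Gamma (x + 1 / 2) / (x - 1 / 2)]. *)
Lemma Gamma_half_step x : 3 / 2 < x ->
  Gamma x <= (1 + (x - 1 / 2)^-1) / 2 * Gamma (x + 1 / 2).
Proof.
move=> x32; apply: le_trans (Gamma_midpoint _ x32) _.
have -> : x + 1 / 2 = (x - 1 / 2) + 1 by field.
rewrite GammaS; last by lra.
rewrite le_eqVlt; apply/orP; left; apply/eqP; field.
by apply/eqP; lra.
Qed.

End gamma.

(* Mathieu series: termwise comparison with zeta and its consequences *)
Local Opaque Gamma zeta.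

(** The majorant also makes the series converge, so that [limn] is its sum. The lower bound serves
    when [p]-th powers are taken. *)
Lemma lim_series_le_zeta {R : realType} (u : R ^nat) (c s : R) : 1 < s -> 0 <= c ->
  (forall k, 0 <= u k <= c * riemannR s k) ->
  0 <= limn (series u) <= c * zeta s.
Proof.
move=> s1 c0 u_le.
have nd (v : R ^nat) : (forall k, 0 <= v k) -> nondecreasing_seq (series v).
  by move=> v0; apply: nondecreasing_series => k _ _; exact: v0.
have rge0 k : 0 <= riemannR s k by rewrite ltW// riemannR_gt0//; lra.
have le_u n : series u n <= c * zeta s.
  apply: (@le_trans _ _ (c * series (riemannR s) n)).
    rewrite /series/= mulr_sumr; apply: ler_sum => k _.
    by have /andP[] := u_le k.
  rewrite ler_wpM2l//; apply: nondecreasing_cvgn_le; first exact: nd.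
  exact: is_cvg_series_riemannR.
have u0 k : 0 <= u k by have /andP[] := u_le k.
have cu : cvgn (series u).
  by apply: nondecreasing_is_cvgn; [exact: nd|exists (c * zeta s) => _ [n _ <-]].
apply/andP; split; last by apply: limr_le => //; exact: nearW.
by apply: limr_ge => //; apply: nearW => n; apply: sumr_ge0.
Qed.

Section mathieu.
Context {R : realType}.
Implicit Types mu r : R.

Let sq_le (x y : R) : 0 <= y -> x ^+ 2 <= y ^+ 2 -> x <= y.
Proof.
move=> y0 xy; case: (lerP 0 x) => [x0|x0]; last by lra.
by rewrite -ler_sqr ?nnegrE.
Qed.

Let quintic_le (a b : R) : 0 <= a -> 0 <= b ->
  160 * (a ^+ 3 * b ^+ 2) <= 9 * (a + b) ^+ 5.
Proof.
move=> a0 b0; have h i j : 0 <= a ^+ i * b ^+ j by rewrite mulr_ge0 ?exprn_ge0.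
(* In the expansion of [9 (a + b)^5 - 160 a^3 b^2], the three terms divisible by [a^2 b] but not by
   [a^5] or [b^4] form [a^2 b] times this quadratic form; the others are nonnegative. *)
have q : 0 <= 45 * a ^+ 2 - 70 * (a * b) + 90 * b ^+ 2.
  have := sqr_ge0 (a - b); have := sqr_ge0 a; have := sqr_ge0 b; lra.
have := mulr_ge0 (h 2 1) q.
have := h 5 0; have := h 1 4; have := h 0 5; lra.
Qed.

(* [(n^2 + r^2) `^ (mu - 1) >= (2 r n) `^ (mu - 1)] and
   [(n^2 + r^2)^4 >= n^8 + 4 n^6 r^2 >= 4 r n^7]. *)
Lemma mathieu_gen_le_zeta mu r : 1 <= mu -> 0 < r ->
  0 <= mathieu_gen mu r <=
    Num.sqrt 2 / (2 * r) `^ (mu - 1 / 2) * zeta (mu + 3 / 2).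
Proof.
move=> mu1 r0; apply: lim_series_le_zeta; first lra.
  by rewrite divr_ge0 ?sqrtr_ge0 ?powR_ge0.
move=> k; rewrite /riemannR; set n : R := k.+1%:R.
have n0 : 0 < n by rewrite ltr0n.
have r20 : 0 < 2 * r by lra.
set A := n ^+ 2 + r ^+ 2.
have A0 : 0 < A by rewrite addr_gt0 ?exprn_gt0.
apply/andP; split; first by rewrite divr_ge0 ?powR_ge0//; lra.
(* Powers with exponent [mu - 1 >= 0] are split off and compared by monotonicity. The rest involves
   only integer powers and square roots, and is compared after squaring. *)
have -> : mu + 1 = (mu - 1) + 2 by ring.
have -> : mu - 1 / 2 = (mu - 1) + 2^-1 by field.
have -> : mu + 3 / 2 = (mu - 1) + (2 + 2^-1) by field.
rewrite (@powRD _ A (mu - 1) 2) ?(gt_eqF A0) ?implybT//.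
rewrite (@powRD _ (2 * r) (mu - 1)) ?(gt_eqF r20) ?implybT//.
rewrite (@powRD _ n (mu - 1)) ?(@powRD _ n 2) ?(gt_eqF n0) ?implybT//.
rewrite !powR12_sqrt ?(ltW n0) ?(ltW r20)// !powR_mulrn ?(ltW n0) ?(ltW A0)//.
set P := (2 * r) `^ _; set Q := n `^ _; set B := A `^ _.
have P0 : 0 < P by exact: powR_gt0.
have Q0 : 0 < Q by exact: powR_gt0.
have B0 : 0 < B by exact: powR_gt0.
have PQB : P * Q <= B.
  rewrite -powRM ?(ltW n0) ?(ltW r20)//; apply: ge0_ler_powR.
  - by rewrite subr_ge0.
  - by rewrite nnegrE mulr_ge0 ?(ltW n0) ?(ltW r20).
  - by rewrite nnegrE ltW.
  - by rewrite /A; have := sqr_ge0 (n - r); lra.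
have s2r : 0 < Num.sqrt (2 * r) by rewrite sqrtr_gt0.
have sn : 0 < Num.sqrt n by rewrite sqrtr_gt0.
rewrite -[leRHS]mulrA -invfM ler_pdivrMr ?mulr_gt0 ?exprn_gt0//.
rewrite mulrAC ler_pdivlMr ?mulr_gt0 ?exprn_gt0//.
have H : 2 * n ^+ 3 * (Num.sqrt (2 * r) * Num.sqrt n) <= Num.sqrt 2 * A ^+ 2.
  apply: sq_le; first by rewrite mulr_ge0 ?sqrtr_ge0 ?exprn_ge0 ?(ltW A0).
  rewrite !exprMn !sqr_sqrtr ?(ltW n0) ?(ltW r20)//.
  have : 4 * (n ^+ 7 * r) <= A ^+ 4.
    have : 0 <= n ^+ 6 * (n - 2 * r) ^+ 2.
      by rewrite mulr_ge0 ?sqr_ge0 ?exprn_ge0 ?(ltW n0).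
    have : 0 <= 6 * (n ^+ 4 * r ^+ 4) + 4 * (n ^+ 2 * r ^+ 6) + r ^+ 8.
      by rewrite !addr_ge0 ?mulr_ge0 ?exprn_ge0 ?(ltW n0) ?(ltW r0).
    rewrite /A; lra.
  lra.
have := ler_pM _ _ PQB H; rewrite !mulr_ge0 ?exprn_ge0 ?(ltW P0) ?(ltW Q0)
  ?(ltW n0) ?(ltW s2r) ?(ltW sn)//.
move=> /(_ isT isT); lra.
Qed.

(** The parameter [d] measures the room in the Gamma quotient: [d = 1] serves (i) and [d = sqrt 2]
    serves (ii). *)
Lemma mathieu_gen_powR_le mu r p d : 1 <= mu -> 0 < r -> 1 < p -> 0 < d ->
  Num.sqrt 2 * d * Gamma (mu + 1) <= Num.sqrt pi * Gamma (mu + 3 / 2) ->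
  mathieu_gen mu r `^ p <= mathieu_const mu r `^ p / d `^ p
    * Gamma (mu + 1 / 2) `^ (p - 1) * zeta (mu + 1 / 2) `^ (p - 1)
    * Gamma (p + mu + 1 / 2) * zeta (p + mu + 1 / 2).
Proof.
move=> mu1 r0 p1 d0 H.
pose a := mu + 1 / 2; have a1 : 1 < a by rewrite /a; lra.
have p0 : 0 < p by lra.
have Ea : mu + 3 / 2 = a + 1 by rewrite /a; field.
have Ep : p + mu + 1 / 2 = a + p by rewrite /a; ring.
rewrite Ep -/a; rewrite Ea in H.
have r2 : 0 < (2 * r) `^ (mu - 1 / 2) by rewrite powR_gt0//; lra.
have G0 : 0 < Gamma (mu + 1) by apply: Gamma_gt0; lra.
have /andP[S0] := mathieu_gen_le_zeta _ _ mu1 r0; rewrite Ea => S1.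
have GI := Gamma_interpolation _ _ p1 a1.
have zI := zeta_interpolation _ _ p1 a1.
have Ga : 0 < Gamma (a + 1) by apply: Gamma_gt0; rewrite ltr_wpDr.
have za : 0 < zeta (a + 1) by apply: zeta_gt0; rewrite ltr_wpDr.
rewrite /mathieu_const; clearbody a.
move: (Gamma (a + 1)) (zeta (a + 1)) (Gamma (mu + 1)) ((2 * r) `^ _) 
  (mathieu_gen mu r) (Gamma a) (zeta a) (Gamma (a + p)) (zeta (a + p))
  (Num.sqrt 2) (Num.sqrt pi) (sqrtr_ge0 (pi : R)) Ga za G0 r2 S0 S1 GI zI H.
move=> G1 Z1 Gm D S G Z Gp Zp q2 qpi qpi0 G10 Z10 Gm0 D0 S0 S1 GI zI H.
have C0 : 0 <= qpi / (D * Gm) by rewrite divr_ge0// mulr_ge0// ltW.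
(* [H] replaces [q2] by [qpi * G1 / (d * Gm)], bringing in the Gamma value that [GI] bounds. *)
have {S1} : S <= qpi / (D * Gm) / d * (G1 * Z1).
  apply: (le_trans S1); rewrite mulrA ler_pM2r// ler_pdivrMr//.
  have -> : qpi / (D * Gm) / d * G1 * D = qpi * G1 / (d * Gm).
    by field; rewrite !gt_eqF.
  by rewrite ler_pdivlMr ?mulr_gt0// mulrA.
move: (qpi / (D * Gm)) C0 => C C0 S1.
have GZ0 : 0 <= G1 * Z1 by rewrite mulr_ge0// ltW.
have dV : 0 <= d^-1 by rewrite invr_ge0 ltW.
have CG0 : 0 <= C / d * (G1 * Z1) by exact: mulr_ge0 (mulr_ge0 C0 dV) GZ0.
apply: le_trans (@ge0_ler_powR _ p (ltW p0) S (C / d * (G1 * Z1)) S0 CG0 S1) _.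
rewrite (@powRM _ (C / d) _ _ (mulr_ge0 C0 dV) GZ0) (@powRM _ C)//.
rewrite (@powRM _ G1) ?(ltW G10) ?(ltW Z10)//.
rewrite -{1}(powR_inv1 (ltW d0)) -powRrM mulN1r powRN -!mulrA.
rewrite ler_wpM2l ?powR_ge0// ler_wpM2l ?invr_ge0 ?powR_ge0//.
apply: le_trans (ler_pM (powR_ge0 _ _) (powR_ge0 _ _) GI zI) _.
by rewrite le_eqVlt; apply/orP; left; apply/eqP; ring.
Qed.

Lemma mathieu_le r : 0 < r ->
  mathieu r <= Num.sqrt (15 * pi * zeta (3 / 2) * zeta (7 / 2))
        / (4 * Num.sqrt (2 * r)) * pi.
Proof.
move=> r0; have pi3 := pi_ge3 R.
have /andP[_ /le_trans] := mathieu_gen_le_zeta 1 r (lexx 1) r0; apply.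
have -> : 1 - 1 / 2 = 2^-1 :> R by field.
have -> : 1 + 3 / 2 = 5 / 2 :> R by field.
rewrite powR12_sqrt; last by lra.
have s0 : 0 < Num.sqrt (2 * r) by rewrite sqrtr_gt0; lra.
have z3 : 0 < zeta (3 / 2) :> R by apply: zeta_gt0; lra.
have z7 : 0 < zeta (7 / 2) :> R by apply: zeta_gt0; lra.
have z5 : 0 < zeta (5 / 2) :> R by apply: zeta_gt0; lra.
have : (zeta (5 / 2) : R) ^+ 2 <= zeta (3 / 2) * zeta (7 / 2).
  have := @zeta_interpolation R 2 (3 / 2) ltac:(lra) ltac:(lra).
  have -> : 3 / 2 + 1 = 5 / 2 :> R by field.
  have -> : 3 / 2 + 2 = 7 / 2 :> R by field.
  have -> : 2 - 1 = 1 :> R by ring.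
  by rewrite powRr1 ?(ltW z3)// powR_mulrn// ltW.
set X := zeta (3 / 2) in z3 *; set Y := zeta (7 / 2) in z7 *.
set Z := zeta (5 / 2) in z5 * => ZXY.
have XY0 : 0 < X * Y by rewrite mulr_gt0.
(* Squared, this reads [8 Z^2 <= 15 pi X Y], which [ZXY] and [3 <= pi] give. The final inequality
   then needs only [2 <= pi]. *)
have T : 2 * (Num.sqrt 2 * Z) <= Num.sqrt (15 * pi * X * Y).
  apply: sq_le; first exact: sqrtr_ge0.
  rewrite !exprMn !sqr_sqrtr//; last by rewrite -mulrA mulr_ge0 ?(ltW XY0)//; lra.
  rewrite -[15 * pi * X * Y]mulrA; nra.
rewrite -(ler_pM2r (_ : 0 < 4 * Num.sqrt (2 * r))); last by rewrite mulr_gt0.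
set s := Num.sqrt (2 * r) in s0 *; set q := Num.sqrt (15 * _ * _ * _) in T *.
have -> : Num.sqrt 2 / s * Z * (4 * s) = 4 * (Num.sqrt 2 * Z).
  by field; rewrite gt_eqF.
have -> : q / (4 * s) * pi * (4 * s) = q * pi by field; rewrite gt_eqF.
have : 0 <= q by exact: sqrtr_ge0.
nra.
Qed.

Lemma mathieu_gen_three_halves_le r : 0 < r ->
  mathieu_gen (3 / 2) r <= pi ^+ 3 / (9 * Num.sqrt 10 * r ^+ 2).
Proof.
move=> r0; have pi3 := pi_ge3 R.
have s10 : 0 < Num.sqrt 10 :> R by rewrite sqrtr_gt0.
have r20 : 0 < r ^+ 2 by rewrite exprn_gt0.
(* With [zeta 2 <= 2] this constant yields [3 / (sqrt 10 * r^2)], which is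
   [3^3 / (9 sqrt 10 * r^2)]: the target with [pi] lowered to 3. *)
have c0 : 0 <= 3 / (2 * Num.sqrt 10 * r ^+ 2).
  by rewrite divr_ge0// !mulr_ge0// ltW.
apply: (@le_trans _ _ (3 / (2 * Num.sqrt 10 * r ^+ 2) * zeta 2)).
  suff /andP[] : 0 <= mathieu_gen (3 / 2) r <=
      3 / (2 * Num.sqrt 10 * r ^+ 2) * zeta 2 by [].
  apply: lim_series_le_zeta => //; first lra.
  move=> k; rewrite /riemannR; set n : R := k.+1%:R.
  have n0 : 0 < n by rewrite ltr0n.
  have n20 : 0 < n ^+ 2 by rewrite exprn_gt0.
  set A := n ^+ 2 + r ^+ 2.
  have A0 : 0 < A by rewrite addr_gt0.
  have sA : 0 < Num.sqrt A by rewrite sqrtr_gt0.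
  apply/andP; split; first by rewrite divr_ge0 ?powR_ge0//; lra.
  have -> : 3 / 2 + 1 = 2 + 2^-1 :> R by field.
  rewrite powRD ?(gt_eqF A0) ?implybT// powR12_sqrt ?(ltW A0)//.
  rewrite !powR_mulrn ?(ltW n0) ?(ltW A0)//.
  rewrite -[leRHS]mulrA -invfM ler_pdivrMr ?mulr_gt0 ?exprn_gt0//.
  rewrite mulrAC ler_pdivlMr ?mulr_gt0 ?exprn_gt0//.
  have H : 4 * n ^+ 3 * r ^+ 2 * Num.sqrt 10 <= 3 * A ^+ 2 * Num.sqrt A.
    apply: sq_le; first by rewrite !mulr_ge0 ?sqrtr_ge0 ?exprn_ge0 ?(ltW A0).
    rewrite !exprMn !sqr_sqrtr ?(ltW A0)//.
    (* The squared estimate, with [160 = 4^2 * 10]. *)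
    have : 160 * ((n ^+ 2) ^+ 3 * (r ^+ 2) ^+ 2) <= 9 * A ^+ 5.
      by apply: quintic_le; rewrite ltW.
    lra.
  lra.
have z2 := @zeta2_le2 R.
apply: (@le_trans _ _ (3 / (2 * Num.sqrt 10 * r ^+ 2) * 2)).
  by rewrite ler_wpM2l.
have -> : 3 / (2 * Num.sqrt 10 * r ^+ 2) * 2 = 3 ^+ 3 / (9 * Num.sqrt 10 * r ^+ 2).
  by field; rewrite !gt_eqF.
rewrite ler_pM2r ?invr_gt0 ?mulr_gt0//.
by rewrite lerXn2r ?nnegrE//; lra.
Qed.
End mathieu.

Theorem theorem1 (R : realType) (p : R) (hp : 1 < p) (r : R) (hr : 0 < r) :
  [/\ forall mu : R, 1 <= mu ->
        mathieu_gen mu r `^ p <=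
          mathieu_const mu r `^ p
          * Gamma (mu + 1 / 2) `^ (p - 1) * zeta (mu + 1 / 2) `^ (p - 1)
          * Gamma (p + mu + 1 / 2) * zeta (p + mu + 1 / 2),
      forall mu : R, 3 / 2 <= mu ->
        mathieu_gen mu r `^ p <=
          mathieu_const mu r `^ p / 2 `^ (p / 2)
          * Gamma (mu + 1 / 2) `^ (p - 1) * zeta (mu + 1 / 2) `^ (p - 1)
          * Gamma (p + mu + 1 / 2) * zeta (p + mu + 1 / 2),
      mathieu r <=
        Num.sqrt (15 * pi * zeta (3 / 2) * zeta (7 / 2))
        / (4 * Num.sqrt (2 * r)) * pi
    & mathieu_gen (3 / 2) r <= pi ^+ 3 / (9 * Num.sqrt 10 * r ^+ 2)].
Proof.
have pi3 := pi_ge3 R.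
split; [move=> mu mu1|move=> mu mu32| |]; last 2 first.
- exact: mathieu_le.
- exact: mathieu_gen_three_halves_le.
- have G0 : 0 < Gamma (mu + 3 / 2) by apply: Gamma_gt0; lra.
  have := @mathieu_gen_powR_le R mu r p 1 mu1 hr hp ltr01.
  rewrite powR1 divr1 mulr1; apply.
  have := @Gamma_half_step R (mu + 1) ltac:(lra).
  have -> : mu + 1 - 1 / 2 = mu + 1 / 2 by field.
  have -> : mu + 1 + 1 / 2 = mu + 3 / 2 by field.
  (* [sqrt 2 <= sqrt pi], and the factor of [Gamma_half_step] is at most 1. *)
  move=> /le_trans H; apply: ler_pM; rewrite ?sqrtr_ge0//.
  + by apply/ltW/Gamma_gt0; lra.
  + by apply: ler_wsqrtr; lra.
  + apply: H; rewrite ger_pMl//.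
    have : (mu + 1 / 2)^-1 <= 1 by rewrite invf_le1; lra.
    lra.
- have G0 : 0 < Gamma (mu + 3 / 2) by apply: Gamma_gt0; lra.
  have mu1 : 1 <= mu by lra.
  have s20 : 0 < Num.sqrt 2 :> R by rewrite sqrtr_gt0.
  have := @mathieu_gen_powR_le R mu r p (Num.sqrt 2) mu1 hr hp s20.
  have -> : Num.sqrt 2 `^ p = 2 `^ (p / 2) :> R.
    by rewrite -(powR12_sqrt (ler0n R 2)) -powRrM mulrC.
  apply.
  rewrite -expr2 sqr_sqrtr//.
  have := @Gamma_half_step R (mu + 1) ltac:(lra).
  have -> : mu + 1 - 1 / 2 = mu + 1 / 2 by field.
  have -> : mu + 1 + 1 / 2 = mu + 3 / 2 by field.
  (* The factor of [Gamma_half_step] is now at most [3 / 4], and twice that is at most [sqrt pi]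
     because [9 / 4 <= pi]. *)
  have : (mu + 1 / 2)^-1 <= 2^-1 by rewrite lef_pV2 ?posrE; lra.
  have : 3 / 2 <= Num.sqrt pi :> R.
    have h0 : 0 <= 3 / 2 :> R by lra.
    by rewrite -[leLHS](ger0_norm h0) -sqrtr_sqr ler_wsqrtr//; lra.
  move: (Num.sqrt pi) ((mu + 1 / 2)^-1) => q v q32 v2 H.
  nra.
Qed.
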